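(* Let $A\in M_k\otimes M_k$ be an SPC matrix having a Hermitian Schmidt decomposition $A=\sum_{i=1}^n\gamma_i\otimes\gamma_i$ (that is, an SPC matrix with all coefficients $\lambda_i=1$). Then: (a) $A$ has a Hermitian Schmidt decomposition $A=\sum_{i=1}^n\gamma_i'\otimes\gamma_i'$ such that $\gamma_i'$ is a positive semidefinite Hermitian matrix for every $1\leq i\leq n$. (b) The decomposition in (a) is unique (up to the order of the summands).
   Context: $M_k$ denotes the complex $k\times k$ matrices, and $M_k\otimes M_m$ is identified with $M_{km}$ via the Kronecker product. $M_k$ carries the inner product $\langle C,D\rangle=\mathrm{tr}(CD^* )$. A Hermitian Schmidt decomposition of a Hermitian $A\in M_k\otimes M_m$ is an expression $A=\sum_{i=1}^n\lambda_i\gamma_i\otimes\delta_i$ with real $\lambda_i>0$, where $\{\gamma_1,\dots,\gamma_n\}\subset M_k$ and $\{\delta_1,\dots,\delta_n\}\subset M_m$ are orthonormal sets of Hermitian matrices. A positive semidefinite Hermitian matrix $A\in M_k\otimes M_k$ is SPC (symmetric with positive coefficients) if it has a Hermitian Schmidt decomposition of the form $A=\sum_{i=1}^n\lambda_i\gamma_i\otimes\gamma_i$ with all $\lambda_i>0$. *)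

(* Defs.v *)
From mathcomp Require Import all_boot all_order all_algebra all_fingroup.
From mathcomp Require Import mxtens.

Set Implicit Arguments.
Unset Strict Implicit.
Unset Printing Implicit Defensive.

Import Order.TTheory GRing.Theory Num.Theory.
Local Open Scope ring_scope.
Local Open Scope sesquilinear_scope.

Section SPC.
Variable C : numClosedFieldType.
Implicit Types k m n : nat.

(* In the order of C, [0 <= z] entails that z is real. *)
Definition psdmx k (A : 'M[C]_k) : Prop :=
  A \is hermsymmx /\ forall x : 'cV[C]_k, 0 <= (x^t* *m A *m x) 0 0.

Definition mxinner k (A B : 'M[C]_k) : C := \tr (A *m B^t*).

(* Orthonormal sets {g_1, ..., g_n} are given as indexed families, which are
   automatically injective. *)
Definition orthonormal_mxs k n (g : 'I_n -> 'M[C]_k) : Prop :=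
  forall i j, mxinner (g i) (g j) = (i == j)%:R.

(* The coefficients are real: [0 < lam i] entails it in the order of C. The
   Kronecker product [*t] orders the index pairs lexicographically. *)
Definition hermitian_schmidt k m n (A : 'M[C]_(k * m)) (lam : 'I_n -> C)
    (g : 'I_n -> 'M[C]_k) (d : 'I_n -> 'M[C]_m) : Prop :=
  [/\ forall i, 0 < lam i,
      forall i, g i \is hermsymmx /\ d i \is hermsymmx,
      orthonormal_mxs g,
      orthonormal_mxs d
    & A = \sum_(i < n) lam i *: (g i *t d i)].

Definition is_SPC k (A : 'M[C]_(k * k)) : Prop :=
  psdmx A /\ exists n (lam : 'I_n -> C) (g : 'I_n -> 'M[C]_k),
    hermitian_schmidt A lam g g.

Definition unit_schmidt k n (A : 'M[C]_(k * k)) (g : 'I_n -> 'M[C]_k) : Prop :=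
  hermitian_schmidt A (fun=> 1) g g.

End SPC.

(* Main.v *)
Require Import Defs.
From mathcomp Require Import all_boot all_order all_algebra all_fingroup.
From mathcomp Require Import reals complex mxtens ring.
From mathcomp Require boolp.

(** With P X = sum_i tr(X gamma_i) gamma_i the orthogonal projection onto
    V = span(gamma), positivity of A says that P maps psd matrices to psd
    matrices.

    Existence. Let Q in V be psd, E its support projection and F = 1 - E. Then
    P F is psd with tr(P F Q) = tr(F Q) = 0, so tr((E (x) F) A (E (x) F)) = 0 and
    A (E (x) F) = 0 because A is psd. Hence P(E M_k) F = 0 and P(F M_k) E = 0, so
    every X in V is E X E + F X F with both blocks in V. If Q has minimal rank
    among the nonzero psd elements of V, then E V E is the line through Q:
    subtracting from Q the right multiple of X in E V E keeps it psd and lowers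
    its rank. Completing a normalised such Q to an orthonormal basis of V, all
    other basis elements are supported on F, so A - Q (x) Q = (F (x) F) A (F (x) F)
    is psd, and one concludes by induction on n.

    Uniqueness. Two psd orthonormal bases of V differ by an orthogonal matrix
    with nonnegative entries, i.e. a permutation matrix. *)

Set Implicit Arguments.
Unset Strict Implicit.
Unset Printing Implicit Defensive.

Import Order.TTheory GRing.Theory Num.Theory.
Local Open Scope ring_scope.
Local Open Scope sesquilinear_scope.

(** * Hermitian and positive semidefinite matrices: traces, spectra, square roots *)

Section HermitianMatrices.
Variable C : numClosedFieldType.

Lemma hermsymmxE k (A : 'M[C]_k) : (A \is hermsymmx) = (A^t* == A).
Proof. by rewrite is_hermitianmxE expr0 scale1r eq_sym. Qed.

Lemma hermsymmxP k (A : 'M[C]_k) : reflect (A^t* = A) (A \is hermsymmx).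
Proof. by rewrite hermsymmxE; exact: eqP. Qed.

Lemma adjmxM m n p (A : 'M[C]_(m, n)) (B : 'M_(n, p)) :
  (A *m B)^t* = B^t* *m A^t*.
Proof. by rewrite trmx_mul map_mxM. Qed.

Lemma adjmxB m n (A B : 'M[C]_(m, n)) : (A - B)^t* = A^t* - B^t*.
Proof. by rewrite linearB map_mxB. Qed.

Lemma adjmxZ m n a (A : 'M[C]_(m, n)) : (a *: A)^t* = a^* *: A^t*.
Proof. by rewrite linearZ map_mxZ. Qed.

Lemma adjmx1 n : (1%:M : 'M[C]_n)^t* = 1%:M.
Proof. by rewrite trmx1 map_mx1. Qed.

Lemma adjmx0 m n : (0 : 'M[C]_(m, n))^t* = 0.
Proof. by rewrite trmx0 map_mx0. Qed.

Lemma mxtrace_adj n (A : 'M[C]_n) : \tr (A^t*) = (\tr A)^*.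
Proof. by rewrite trace_map_mx mxtrace_tr. Qed.

Lemma mxtrace_gram m n (B : 'M[C]_(m, n)) :
  \tr (B^t* *m B) = \sum_j \sum_i `|B i j| ^+ 2.
Proof.
apply: eq_bigr => j _; rewrite mxE; apply: eq_bigr => i _.
by rewrite !mxE mulrC normCK.
Qed.

Lemma mxtrace_gram_ge0 m n (B : 'M[C]_(m, n)) : 0 <= \tr (B^t* *m B).
Proof.
by rewrite mxtrace_gram; do 2!apply: sumr_ge0 => ? _; rewrite exprn_ge0.
Qed.

Lemma mxtrace_gram_eq0 m n (B : 'M[C]_(m, n)) : \tr (B^t* *m B) = 0 -> B = 0.
Proof.
rewrite mxtrace_gram => B0; apply/matrixP => i j; rewrite mxE.
have sq_ge0 j' i' : 0 <= `|B i' j'| ^+ 2 by rewrite exprn_ge0.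
have Bj : \sum_i' `|B i' j| ^+ 2 = 0.
  by apply: (psumr_eq0P (fun j' _ => sumr_ge0 _ (fun i' _ => sq_ge0 j' i')) B0).
have /(_ i isT)/eqP := psumr_eq0P (fun i' _ => sq_ge0 j i') Bj.
by rewrite sqrf_eq0 normr_eq0 => /eqP.
Qed.

Lemma psdmx_gram m n (B : 'M[C]_(m, n)) : psdmx (B^t* *m B).
Proof.
split; first by apply/hermsymmxP; rewrite adjmxM trmxCK.
move=> x; rewrite -[X in 0 <= X]mulr1n -trace_mx11 mulmxA.
by rewrite -adjmxM -mulmxA mxtrace_gram_ge0.
Qed.

Lemma spectralP k (A : 'M[C]_k) : A \is hermsymmx ->
  exists U (d : 'rV[C]_k), [/\ U \is unitarymx, A = U^t* *m diag_mx d *m U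
    & forall i, d 0 i \is Num.real].
Proof.
move=> hA; exists (spectralmx A), (spectral_diag A).
have U := spectral_unitarymx A; split=> //; last first.
  by move=> i; have /mxOverP := hermitian_spectral_diag_real hA; apply.
by rewrite -invmx_unitary //; apply/orthomx_spectralP/hermitian_normalmx.
Qed.

Lemma unitary_adjK k (U : 'M[C]_k) : U \is unitarymx -> U^t* *m U = 1%:M.
Proof. by move=> /unitarymxP /mulmx1C. Qed.

Lemma conj_diag_mul k (U : 'M[C]_k) (d e : 'rV[C]_k) : U \is unitarymx ->
  (U^t* *m diag_mx d *m U) *m (U^t* *m diag_mx e *m U) =
  U^t* *m diag_mx (\row_i (d 0 i * e 0 i)) *m U.
Proof.
move=> Uu; rewrite !mulmxA -[_ *m U *m _]mulmxA (unitarymxP Uu) mulmx1.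
by rewrite -[_ *m diag_mx d *m _]mulmxA mulmx_diag.
Qed.

Lemma conj_diag_herm k (U : 'M[C]_k) (d : 'rV[C]_k) :
  (forall i, d 0 i \is Num.real) -> (U^t* *m diag_mx d *m U)^t* =
  U^t* *m diag_mx d *m U.
Proof.
move=> dr; rewrite !adjmxM trmxCK mulmxA tr_diag_mx map_diag_mx.
by congr (_ *m diag_mx _ *m _); apply/rowP => i; rewrite mxE; apply/CrealP.
Qed.

Lemma conj_diag_form k (U : 'M[C]_k) (d : 'rV[C]_k) (x : 'cV[C]_k) :
  (x^t* *m (U^t* *m diag_mx d *m U) *m x) 0 0 =
  \sum_i d 0 i * `|(U *m x) i 0| ^+ 2.
Proof.
rewrite !mulmxA -adjmxM -mulmxA mxE; apply: eq_bigr => i _.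
rewrite mul_mx_diag mxE [_^t* _ _]mxE [_^T _ _]mxE normCK.
by rewrite [LHS]mulrC [RHS]mulrCA [_^* * _]mulrC.
Qed.

Lemma psdmx_conj_diag k (U : 'M[C]_k) (d : 'rV[C]_k) :
  (forall i, 0 <= d 0 i) -> psdmx (U^t* *m diag_mx d *m U).
Proof.
move=> d0; split.
  by apply/hermsymmxP; rewrite conj_diag_herm // => i; apply: ger0_real.
move=> x; rewrite conj_diag_form; apply: sumr_ge0 => i _.
by rewrite mulr_ge0 // exprn_ge0.
Qed.

Lemma psdmx_spectral k (A : 'M[C]_k) : psdmx A ->
  exists U (d : 'rV[C]_k), [/\ U \is unitarymx, A = U^t* *m diag_mx d *m U
    & forall i, 0 <= d 0 i].
Proof.
case=> /spectralP[U [d [Uu -> dr]]] A0; exists U, d; split=> // i.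
(* Testing on the eigenvector of the [i]-th eigenvalue isolates [d 0 i]. *)
have := A0 (U^t* *m delta_mx i 0).
rewrite conj_diag_form mulmxA (unitarymxP Uu) mul1mx (bigD1 i) //= big1.
  by rewrite mxE !eqxx normr1 expr1n mulr1 addr0.
by move=> j /negPf ji; rewrite mxE ji normr0 expr0n mulr0.
Qed.

(* [S] is the Moore-Penrose inverse of the square root [T] of [A], so that
   [T *m S] is the orthogonal projection onto the range of [A]. *)
Lemma psdmx_sqrt k (A : 'M[C]_k) : psdmx A ->
  exists T S : 'M[C]_k, [/\ T^t* = T, S^t* = S, A = T *m T, T *m S = S *m T
    & T *m S *m T = T /\ S *m T *m S = S].
Proof.
case/psdmx_spectral=> U [d [Uu -> d0]].
pose M (e : 'rV[C]_k) := U^t* *m diag_mx e *m U.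
have MM e f : M e *m M f = M (\row_i (e 0 i * f 0 i)) by apply: conj_diag_mul.
(* As [0^-1 = 0], the second matrix inverts the nonzero eigenvalues and keeps the kernel. *)
exists (M (\row_i sqrtC (d 0 i))), (M (\row_i (sqrtC (d 0 i))^-1)).
have s0 i : 0 <= sqrtC (d 0 i) by rewrite sqrtC_ge0.
have Mrow (e f : 'rV[C]_k) : (forall i, e 0 i = f 0 i) -> M e = M f.
  by move=> ef; congr M; apply/rowP.
split; rewrite ?MM //.
- by apply: conj_diag_herm => i; rewrite mxE ger0_real.
- by apply: conj_diag_herm => i; rewrite mxE ger0_real // invr_ge0.
- by apply: Mrow => i; rewrite !mxE -expr2 sqrtCK.
- by apply: Mrow => i; rewrite !mxE mulrC.
- split; apply: Mrow => i; rewrite !mxE.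
    by have [->|/mulfV->] := eqVneq (sqrtC (d 0 i)) 0; rewrite ?mul0r ?mul1r ?mulr0.
  have [->|/mulVf->] := eqVneq (sqrtC (d 0 i)) 0; rewrite ?mul1r //.
  by rewrite invr0 !mul0r.
Qed.

Lemma psdmx_factor k (A : 'M[C]_k) : psdmx A ->
  exists B : 'M[C]_k, A = B^t* *m B.
Proof. by case/psdmx_sqrt=> T [_ [hT _ -> _ _]]; exists T; rewrite hT. Qed.

Lemma psdmx_congr m n (A : 'M[C]_m) (M : 'M[C]_(m, n)) :
  psdmx A -> psdmx (M^t* *m A *m M).
Proof.
by case/psdmx_factor=> B ->; rewrite -!mulmxA mulmxA -adjmxM; apply: psdmx_gram.
Qed.

Lemma psdmx_tr_ge0 k (A : 'M[C]_k) : psdmx A -> 0 <= \tr A.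
Proof. by case/psdmx_factor=> B ->; apply: mxtrace_gram_ge0. Qed.

Lemma psdmx_tr_congr_eq0 m n (A : 'M[C]_m) (M : 'M[C]_(m, n)) :
  psdmx A -> \tr (M^t* *m A *m M) = 0 -> A *m M = 0.
Proof.
case/psdmx_factor=> B ->; rewrite -!mulmxA mulmxA -adjmxM => /mxtrace_gram_eq0.
by move=> ->; rewrite mulmx0.
Qed.

(** Makes the trace of a product of two psd matrices a squared Frobenius norm, which gives both its
    sign and the case where it vanishes. *)
Lemma mxtrace_mul_gram k (B D : 'M[C]_k) :
  \tr (B^t* *m B *m (D^t* *m D)) = \tr ((B *m D^t*)^t* *m (B *m D^t*)).
Proof. by rewrite adjmxM trmxCK mulmxA mxtrace_mulC -!mulmxA. Qed.

Lemma psdmx_tr_mul_ge0 k (G Q : 'M[C]_k) :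
  psdmx G -> psdmx Q -> 0 <= \tr (G *m Q).
Proof.
case/psdmx_factor=> B -> /psdmx_factor[D ->].
by rewrite mxtrace_mul_gram mxtrace_gram_ge0.
Qed.

Lemma psdmx_tr_mul_eq0 k (G Q : 'M[C]_k) :
  psdmx G -> psdmx Q -> \tr (G *m Q) = 0 -> G *m Q = 0.
Proof.
case/psdmx_factor=> B -> /psdmx_factor[D ->].
rewrite mxtrace_mul_gram => /mxtrace_gram_eq0 BD.
by rewrite -mulmxA [B *m _]mulmxA BD mul0mx mulmx0.
Qed.

(** Take for [y] an eigenvalue of largest absolute value: then no eigenvalue of [y^-1 *: Y] exceeds
    1. *)
Lemma hermsymmx_extremal_eigenvector k (Y : 'M[C]_k) : Y \is hermsymmx -> Y != 0 ->
  exists (y : C) (v : 'cV[C]_k), [/\ y \is Num.real, y != 0, v != 0,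
    Y *m v = y *: v & psdmx (1%:M - y^-1 *: Y)].
Proof.
case/spectralP=> U [d [Uu -> dr]] Y0.
have [i0 di0] : exists i0, d 0 i0 != 0.
  apply/existsP; apply: contra_neqT Y0 => /existsPn d0.
  have -> : d = 0 by apply/rowP => i; rewrite mxE; have /eqP := negbNE (d0 i).
  by rewrite linear0 mulmx0 mul0mx.
have [i _ imax] := @real_arg_maxP _ _ i0 xpredT (fun i => `|d 0 i|) isT
  (fun i _ => normr_real _).
have di : d 0 i != 0.
  by rewrite -normr_gt0 (lt_le_trans _ (imax i0 isT)) // normr_gt0.
exists (d 0 i), (U^t* *m delta_mx i 0); split=> //.
- apply: contra_neq di => /(congr1 (mulmx U)).
  rewrite mulmxA (unitarymxP Uu) mul1mx mulmx0 => /matrixP/(_ i 0).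
  by rewrite !mxE !eqxx => /eqP; rewrite oner_eq0.
- rewrite !mulmxA -[_ *m U *m _]mulmxA (unitarymxP Uu) mulmx1 -mulmxA.
  rewrite mul_diag_mx scalemxAr; congr (_ *m _); apply/colP => j.
  by rewrite !mxE; case: eqP => [->|]; rewrite ?mulr0.
- have -> : 1%:M - (d 0 i)^-1 *: (U^t* *m diag_mx d *m U) =
    U^t* *m diag_mx (\row_j (1 - (d 0 i)^-1 * d 0 j)) *m U.
    have -> : \row_j (1 - (d 0 i)^-1 * d 0 j) = const_mx 1 - (d 0 i)^-1 *: d.
      by apply/rowP => j; rewrite !mxE.
    rewrite [diag_mx (_ - _)]linearB /= [diag_mx (_ *: _)]linearZ /= diag_const_mx.
    rewrite mulmxBr mulmxBl mulmx1 unitary_adjK //.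
    by rewrite -scalemxAr -scalemxAl.
  apply: psdmx_conj_diag => j; rewrite mxE subr_ge0.
  have rdd : (d 0 i)^-1 * d 0 j \is Num.real by rewrite realM ?realV.
  apply: le_trans (real_ler_norm rdd) _.
  by rewrite normrM normfV mulrC ler_pdivrMr ?normr_gt0 // mul1r; exact: imax.
Qed.

(** [E] is the orthogonal projection onto the range of [Q], and [R] the pseudo-inverse of [Q]. The
    factorization [E = Q *m R] turns any left annihilator of [Q] into one of [E]. *)
Lemma psdmx_support k (Q : 'M[C]_k) : psdmx Q ->
  exists E R : 'M[C]_k, [/\ E^t* = E, E *m E = E, E *m Q = Q & E = Q *m R].
Proof.
case/psdmx_sqrt=> T [S [hT hS -> TS [TST STS]]].
exists (T *m S), (S *m S); split.
- by rewrite adjmxM hT hS TS.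
- by rewrite mulmxA TST.
- by rewrite mulmxA TST.
- by rewrite TS !mulmxA -[T *m T *m S]mulmxA TS !mulmxA TST -TS.
Qed.

End HermitianMatrices.

(** * Kronecker products and partial traces *)

Section TensorProducts.
Variable C : numClosedFieldType.

Lemma mxtrace_tens m n (A : 'M[C]_m) (B : 'M[C]_n) :
  \tr (A *t B) = \tr A * \tr B.
Proof. by rewrite mulr_sum; apply: eq_bigr => i _; rewrite !mxE. Qed.

Lemma adjmx_tens m n p q (A : 'M[C]_(m, n)) (B : 'M[C]_(p, q)) :
  (A *t B)^t* = A^t* *t B^t*.
Proof. by rewrite trmx_tens map_mxT. Qed.

(** The partial trace over the first factor of [(X *t 1%:M) *m A]. *)
Definition contract m n p q (X : 'M[C]_(n, m)) (A : 'M[C]_(m * p, n * q)) :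
    'M[C]_(p, q) :=
  \matrix_(r, s) \sum_a \sum_b
    X a b * A (mxtens_index (b, r)) (mxtens_index (a, s)).

Lemma contract_sum_tens m n p q N (X : 'M[C]_(n, m)) (a : 'I_N -> 'M[C]_(m, n))
    (b : 'I_N -> 'M[C]_(p, q)) :
  contract X (\sum_i a i *t b i) = \sum_i \tr (X *m a i) *: b i.
Proof.
apply/matrixP => r s; rewrite mxE summxE.
transitivity (\sum_u \sum_v \sum_i X u v * a i v u * b i r s).
  apply: eq_bigr => u _; apply: eq_bigr => v _; rewrite summxE mulr_sumr.
  by apply: eq_bigr => i _; rewrite tensmxE mulrA.
under eq_bigr => u _ do rewrite exchange_big /=.
rewrite exchange_big /=; apply: eq_bigr => i _.
rewrite mxE mulr_suml; apply: eq_bigr => u _.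
by rewrite mxE mulr_suml.
Qed.

Lemma mulmx_tens_suml m n p q r s N (M : 'M[C]_(m, n)) (M' : 'M[C]_(p, q))
    (a : 'I_N -> 'M[C]_(n, r)) (b : 'I_N -> 'M[C]_(q, s)) :
  (M *t M') *m (\sum_i a i *t b i) = \sum_i (M *m a i) *t (M' *m b i).
Proof. by rewrite mulmx_sumr; apply: eq_bigr => i _; rewrite tensmx_mul. Qed.

Lemma mulmx_tens_sumr m n p q r s N (M : 'M[C]_(n, r)) (M' : 'M[C]_(q, s))
    (a : 'I_N -> 'M[C]_(m, n)) (b : 'I_N -> 'M[C]_(p, q)) :
  (\sum_i a i *t b i) *m (M *t M') = \sum_i (a i *m M) *t (b i *m M').
Proof. by rewrite mulmx_suml; apply: eq_bigr => i _; rewrite tensmx_mul. Qed.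

End TensorProducts.

(** * The projection onto the span of the family, and its positivity *)

Section SpanProjection.
Variables (C : numClosedFieldType) (k : nat).

Definition trace_orthonormal n (g : 'I_n -> 'M[C]_k) : Prop :=
  forall i j, \tr (g i *m g j) = (i == j)%:R.

(* For a trace-orthonormal Hermitian family, the orthogonal projection onto
   its span; it depends only on [\sum_i g i *t g i]. *)
Definition spanproj n (g : 'I_n -> 'M[C]_k) (X : 'M[C]_k) : 'M[C]_k :=
  \sum_i \tr (X *m g i) *: g i.

Lemma spanproj_contract n (g : 'I_n -> 'M[C]_k) X :
  spanproj g X = contract X (\sum_i g i *t g i).
Proof. by rewrite contract_sum_tens. Qed.

Lemma eq_spanproj m n (g : 'I_m -> 'M[C]_k) (h : 'I_n -> 'M[C]_k) X :
  \sum_i g i *t g i = \sum_i h i *t h i -> spanproj g X = spanproj h X.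
Proof. by rewrite !spanproj_contract => ->. Qed.

Section Family.
Variables (n : nat) (g : 'I_n -> 'M[C]_k).
Implicit Types X Y Q : 'M[C]_k.
Local Notation P := (spanproj g).

Lemma spanprojD X Y : P (X + Y) = P X + P Y.
Proof.
rewrite -big_split; apply: eq_bigr => i _ /=.
by rewrite mulmxDl linearD scalerDl.
Qed.

Lemma spanprojZ a X : P (a *: X) = a *: P X.
Proof.
rewrite scaler_sumr; apply: eq_bigr => i _ /=.
by rewrite -scalemxAl linearZ scalerA.
Qed.

Lemma spanprojN X : P (- X) = - P X.
Proof. by rewrite -scaleN1r spanprojZ scaleN1r. Qed.

Lemma mxtrace_spanproj X Y :
  \tr (P X *m Y) = \sum_i \tr (X *m g i) * \tr (g i *m Y).
Proof.
rewrite mulmx_suml linear_sum; apply: eq_bigr => i _ /=.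
by rewrite -scalemxAl linearZ.
Qed.

Lemma spanproj_sym X Y : \tr (P X *m Y) = \tr (X *m P Y).
Proof.
rewrite mxtrace_spanproj [RHS]mxtrace_mulC mxtrace_spanproj.
by apply: eq_bigr => i _; rewrite mulrC mxtrace_mulC [\tr (X *m _)]mxtrace_mulC.
Qed.

Hypothesis g_herm : forall i, (g i)^t* = g i.

Lemma spanproj_adj X : (P X)^t* = P (X^t*).
Proof.
rewrite linear_sum /= raddf_sum; apply: eq_bigr => i _ /=.
by rewrite adjmxZ g_herm -mxtrace_adj adjmxM g_herm mxtrace_mulC.
Qed.

Hypothesis g_orth : trace_orthonormal g.

Lemma spanproj_id i : P (g i) = g i.
Proof.
rewrite /spanproj (bigD1 i) //= big1 ?addr0 => [|j /negPf ji].
  by rewrite g_orth eqxx scale1r.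
by rewrite g_orth eq_sym ji scale0r.
Qed.

Lemma spanproj_idem X : P (P X) = P X.
Proof.
apply: eq_bigr => i _; congr (_ *: _).
by rewrite spanproj_sym spanproj_id.
Qed.

Hypothesis g_psd : psdmx (\sum_i g i *t g i).

(** The bridge between the tensor sum and [P]: signs and zeros of its form on product matrices
    become those of pairings with [P]. *)
Lemma form_tens_gram m p (M : 'M[C]_(k, m)) (N : 'M[C]_(k, p))
    (A := \sum_i g i *t g i) :
  \tr ((M *t N)^t* *m A *m (M *t N)) =
  \tr (P (M *m M^t*) *m (N *m N^t*)).
Proof.
rewrite adjmx_tens mulmx_tens_suml mulmx_tens_sumr linear_sum mxtrace_spanproj.
apply: eq_bigr => i _ /=.
rewrite mxtrace_tens; congr (_ * _); first by rewrite mxtrace_mulC mulmxA.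
by rewrite -mulmxA mxtrace_mulC -mulmxA.
Qed.

Lemma psdmx_spanproj X : psdmx X -> psdmx (P X).
Proof.
move=> X0; split.
  by apply/hermsymmxP; rewrite spanproj_adj; case: X0 => /hermsymmxP->.
have [T [_ [hT _ -> _ _]]] := psdmx_sqrt X0 => y.
rewrite -[X in 0 <= X]mulr1n -trace_mx11 -mulmxA mxtrace_mulC -mulmxA.
(* With [X = T *m T^t*], the form of [P X] at [y] is the trace of the congruence of the tensor sum
   by [T *t y]. *)
rewrite -{2}hT -form_tens_gram; exact/psdmx_tr_ge0/psdmx_congr.
Qed.

(** [g i] may be indefinite, so project [v *m v^t*] instead, for [v] an eigenvector of [g i] with
    eigenvalue [y != 0]. Its pairing with [g i] is [y] times the squared norm of [v], so the
    projection is nonzero. *)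
Lemma spanproj_psdmx_neq0 (i : 'I_n) :
  exists Q, [/\ psdmx Q, P Q = Q & Q != 0].
Proof.
have gi0 : g i != 0.
  apply/eqP => gi0; have /eqP := g_orth i i.
  by rewrite gi0 mul0mx mxtrace0 eqxx eq_sym oner_eq0.
have gih : g i \is hermsymmx by apply/hermsymmxP.
have [y [v [_ y0 v0 gv _]]] := hermsymmx_extremal_eigenvector gih gi0.
exists (P (v *m v^t*)); split; last 1 first.
- apply: contra_neq v0 => Pv0.
  have /eqP : \tr (P (v *m v^t*) *m g i) = 0 by rewrite Pv0 mul0mx mxtrace0.
  rewrite spanproj_sym spanproj_id -mulmxA mxtrace_mulC -mulmxA gv -scalemxAr.
  by rewrite linearZ mulf_eq0 (negPf y0) => /eqP /mxtrace_gram_eq0.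
- by apply: psdmx_spanproj; rewrite -{1}[v]trmxCK; apply: psdmx_gram.
- exact: spanproj_idem.
Qed.

(** Positivity upgrades the vanishing trace to the vanishing of the tensor sum times [M *t N]; the
    conclusion is its contraction with [Z]. *)
Lemma tens_mul_eq0_contract m (M N : 'M[C]_(k, m)) Z :
  \tr (P (M *m M^t*) *m (N *m N^t*)) = 0 ->
  \sum_i \tr (Z *m (g i *m M)) *: (g i *m N) = 0.
Proof.
rewrite -form_tens_gram => /(psdmx_tr_congr_eq0 g_psd).
rewrite mulmx_tens_sumr -contract_sum_tens => ->.
by apply/matrixP => r s; rewrite !mxE big1 // => a _; rewrite big1 // => b _;
   rewrite mxE mulr0.
Qed.

(** * Block splitting along the support of a psd matrix in the span *)

Section Support.
Variables Q E R : 'M[C]_k.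
Hypotheses (Q_psd : psdmx Q) (PQ : P Q = Q).
Hypotheses (E_adj : E^t* = E) (EE : E *m E = E) (EQ : E *m Q = Q).
Hypothesis E_Q : E = Q *m R.
Local Notation F := (1%:M - E).

Let F_adj : F^t* = F. Proof. by rewrite adjmxB adjmx1 E_adj. Qed.
Let FF : F *m F = F.
Proof. by rewrite mulmxBr mulmx1 mulmxBl mul1mx EE subrr subr0. Qed.
Let FQ : F *m Q = 0. Proof. by rewrite mulmxBl mul1mx EQ subrr. Qed.

Let spanproj_F_E : P F *m E = 0.
Proof.
have F_psd : psdmx F by rewrite -FF -{1}F_adj; apply: psdmx_gram.
have /psdmx_tr_mul_eq0 : psdmx (P F) by apply: psdmx_spanproj.
move=> /(_ _ Q_psd); rewrite spanproj_sym PQ FQ mxtrace0 => /(_ erefl) PFQ.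
by rewrite [X in _ *m X]E_Q mulmxA PFQ mul0mx.
Qed.

(** By cyclicity of the trace, [P (E *m Z) *m F] is a contraction of the tensor sum times [E *t F],
    which is zero. *)
Lemma spanproj_support_mulr Z : P (E *m Z) *m F = 0.
Proof.
rewrite mulmx_suml -[RHS](@tens_mul_eq0_contract _ E F Z).
  apply: eq_bigr => i _.
  by rewrite -scalemxAl -mulmxA mxtrace_mulC -mulmxA.
by rewrite E_adj F_adj EE FF spanproj_sym mxtrace_mulC spanproj_F_E mxtrace0.
Qed.

Lemma spanproj_kernel_mulr Z : P (F *m Z) *m E = 0.
Proof.
rewrite mulmx_suml -[RHS](@tens_mul_eq0_contract _ F E Z).
  apply: eq_bigr => i _.
  by rewrite -scalemxAl -mulmxA mxtrace_mulC -mulmxA.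
by rewrite E_adj F_adj EE FF spanproj_F_E mxtrace0.
Qed.

(** The squared norm of [P Z] is the trace of [Z^t* *m P Z], zero because [Z^t*] starts with [F] and
    [P Z *m F = 0]. So [Z] is orthogonal to the span, in particular to [X]; but its pairing with [X]
    is its own squared norm. *)
Lemma spanproj_fixed_corner X : P X = X -> E *m X *m F = 0.
Proof.
move=> PX; set Z := E *m X *m F.
have Zadj : Z^t* = F *m X^t* *m E by rewrite !adjmxM E_adj F_adj mulmxA.
have PZF : P Z *m F = 0 by rewrite /Z -mulmxA spanproj_support_mulr.
have PZ0 : P Z = 0.
  apply: mxtrace_gram_eq0; rewrite spanproj_adj spanproj_sym spanproj_idem.
  by rewrite Zadj -!mulmxA mxtrace_mulC -!mulmxA PZF !mulmx0 mxtrace0.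
apply: mxtrace_gram_eq0.
have -> : \tr (Z^t* *m Z) = \tr (Z^t* *m X).
  rewrite {2}/Z Zadj mulmxA mxtrace_mulC !mulmxA FF.
  by rewrite -[_ *m E *m E]mulmxA EE.
by rewrite -PX -spanproj_sym -spanproj_adj PZ0 adjmx0 mul0mx mxtrace0.
Qed.

Lemma spanproj_fixed_cornerC X : P X = X -> F *m X *m E = 0.
Proof.
move=> PX; have EXF : E *m X^t* *m F = 0.
  by apply: spanproj_fixed_corner; rewrite -spanproj_adj PX.
have := congr1 (fun M : 'M_k => M^t*) EXF.
by rewrite /= !adjmxM trmxCK E_adj F_adj adjmx0 mulmxA.
Qed.

Lemma spanproj_fixed_block X : P X = X ->
  X = E *m X *m E + F *m X *m F /\ P (E *m X *m E) = E *m X *m E.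
Proof.
move=> PX; have [EXF FXE] := (spanproj_fixed_corner PX, spanproj_fixed_cornerC PX).
have X_E : X *m E = E *m X *m E.
  by apply/eqP; rewrite -subr_eq0 -mulmxBl -{1}[X]mul1mx -mulmxBl FXE.
have E_X : E *m X = E *m X *m E.
  by apply/eqP; rewrite -subr_eq0 -{1}[E *m X]mulmx1 -mulmxBr EXF.
have XEF : X = E *m X *m E + F *m X *m F.
  by rewrite [F *m X *m F]mulmxBr mulmx1 FXE subr0 mulmxBl mul1mx -E_X addrC subrK.
split=> //; set Y := E *m X *m E.
have PYF : P Y *m F = 0 by rewrite /Y -mulmxA spanproj_support_mulr.
have <- : P Y *m E = P Y.
  by apply/eqP; rewrite eq_sym -subr_eq0 -{1}[P Y]mulmx1 -mulmxBr PYF.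
(* Right multiplication by [E] kills the [F] block's projection and fixes [P Y], leaving
   [P Y = X *m E = Y]. *)
have : X *m E = (P Y + P (F *m X *m F)) *m E by rewrite -spanprojD -XEF PX.
rewrite [(P Y + _) *m E]mulmxDl -[F *m X *m F]mulmxA spanproj_kernel_mulr addr0.
by rewrite X_E => <-.
Qed.

End Support.

(** Write [Q = T *m T] and [X = T *m Y *m T]. For the extremal eigenpair [(y, v)] of [Y], the matrix
    [Q - y^-1 *: X] stays psd and kills [S *m v], which [Q] does not kill, so the rank drops. *)
Lemma spanproj_fixed_lower_rank Q X : psdmx Q -> P Q = Q ->
    X \is hermsymmx -> P X = X -> (X <= Q)%MS -> (forall c, X != c *: Q) ->
  exists Z, [/\ psdmx Z, P Z = Z, Z != 0 & (\rank Z < \rank Q)%N].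
Proof.
move=> Q0 PQ hX PX /submxP[D XD] XQ.
have [T [S [hT hS QT TS [TST STS]]]] := psdmx_sqrt Q0.
have XE : X *m (S *m T) = X 
  by rewrite XD QT !mulmxA -[_ *m T *m S]mulmxA -[_ *m (T *m S) *m T]mulmxA TST.
have EX : T *m S *m X = X.
  by have := congr1 (fun M : 'M_k => M^t*) XE; rewrite /= !adjmxM hT hS
    (hermsymmxP _ hX).
set Y := S *m X *m S.
have XY : T *m Y *m T = X by rewrite /Y -!mulmxA XE mulmxA EX.
have hY : Y \is hermsymmx.
  by apply/hermsymmxP; rewrite /Y !adjmxM hS (hermsymmxP _ hX) mulmxA.
have Y0 : Y != 0.
  apply: contraNneq (XQ 0) => Y0.
  by rewrite scale0r -XY Y0 mulmx0 mul0mx.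
have [y [v [_ y0 v0 Yv Ypsd]]] := hermsymmx_extremal_eigenvector hY Y0.
pose Z := Q - y^-1 *: X.
have ZT : Z = T *m (1%:M - y^-1 *: Y) *m T.
  by rewrite mulmxBr mulmx1 mulmxBl -QT -scalemxAr -scalemxAl XY.
have Z0 : Z != 0.
  apply: contraNneq (XQ y) => /eqP; rewrite subr_eq0 => /eqP ->.
  by rewrite scalerA mulfV // scale1r.
(* [v] is a multiple of [Y *m v], hence lies in the range of [S], which [T *m S] fixes. *)
have TSv : T *m S *m v = v.
  apply: (scalerI y0); rewrite scalemxAr -Yv /Y.
  by rewrite TS !mulmxA STS.
have ZSv : Z *m (S *m v) = 0.
  rewrite ZT -mulmxA [T *m (S *m v)]mulmxA TSv -mulmxA mulmxBl mul1mx.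
  by rewrite -scalemxAl Yv scalerA mulVf // scale1r subrr mulmx0.
have QSv : Q *m (S *m v) != 0.
  rewrite QT -mulmxA [T *m (S *m v)]mulmxA TSv; apply: contra_neq v0 => Tv.
  by rewrite -TSv TS -mulmxA Tv mulmx0.
have ZQ : (Z <= Q)%MS.
  by rewrite addmx_sub // eqmx_opp scalemx_sub // XD submxMl.
exists Z; split=> //.
- by rewrite ZT -{1}hT; apply: psdmx_congr.
- by rewrite spanprojD spanprojN spanprojZ PQ PX.
- rewrite ltn_neqAle mxrankS // andbT; apply: contra_neqN QSv => /eqP rZQ.
  have : (Q <= Z)%MS by rewrite -(geq_leqif (mxrank_leqif_sup ZQ)) rZQ.
  by case/submxP=> D' ->; rewrite -mulmxA ZSv mulmx0.
Qed.

(** Descent on the rank, starting from any nonzero psd element of the span. *)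
Lemma spanproj_atom (i : 'I_n) : exists Q, [/\ psdmx Q, P Q = Q, Q != 0 &
  forall X, X \is hermsymmx -> P X = X -> (X <= Q)%MS -> exists c, X = c *: Q].
Proof.
have [Q [Q0 PQ Qn0]] := spanproj_psdmx_neq0 i.
have [r] := ubnP (\rank Q); elim: r => // r IHr in Q Q0 PQ Qn0 *.
rewrite ltnS => rQ.
have [[X [hX PX XQ Xn]]|Qatom] := boolp.pselect (exists X, [/\ X \is hermsymmx,
    P X = X, (X <= Q)%MS & forall c, X != c *: Q]).
  have [Z [Z0 PZ Zn0 rZ]] := spanproj_fixed_lower_rank Q0 PQ hX PX XQ Xn.
  exact: IHr Z0 PZ Zn0 (leq_trans rZ rQ).
exists Q; split=> // X hX PX XQ; apply: boolp.contrapT => Xn; apply: Qatom.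
exists X; split=> // c; apply/eqP => Xc; apply: Xn; by exists c.
Qed.

End Family.
End SpanProjection.

(** * Changes of orthonormal basis; existence and uniqueness of the psd one *)

Section Decompositions.
Variables (C : numClosedFieldType) (k : nat).
Implicit Types Q X Y : 'M[C]_k.

Lemma sum_tens_orthonormal_change n (g h : 'I_n -> 'M[C]_k) :
    trace_orthonormal h -> (forall i, spanproj g (h i) = h i) ->
  \sum_i h i *t h i = \sum_i g i *t g i.
Proof.
move=> h_orth Ph.
(* With vectorized matrices as rows, the tensor sums are [G^T *m G] and [H^T *m H] up to a
   reshuffling of entries, and the change of basis [M] is orthogonal. *)
pose G := \matrix_i mxvec (g i); pose H := \matrix_i mxvec (h i).
pose M := \matrix_(i, j) \tr (h i *m g j).
have HMG : H = M *m G.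
  apply/row_matrixP => i; rewrite row_mul rowK -{1}Ph linear_sum mulmx_sum_row.
  by apply: eq_bigr => j _; rewrite linearZ rowK !mxE.
have MM : M *m M^T = 1%:M.
  apply/matrixP => i j; rewrite !mxE -h_orth -[h i]Ph mxtrace_spanproj.
  by apply: eq_bigr => l _; rewrite !mxE [\tr (g l *m _)]mxtrace_mulC.
have HG : H^T *m H = G^T *m G.
  by rewrite HMG trmx_mul mulmxA -[_ *m _ *m M]mulmxA (mulmx1C MM) mulmx1.
apply/matrixP => r s; case: (mxtens_indexP r) => a b; case: (mxtens_indexP s) => c d.
have := congr1 (fun L : 'M_(k * k) => L (mxvec_index a c) (mxvec_index b d)) HG.
rewrite /= !mxE !summxE => HGe.
transitivity (\sum_i H^T (mxvec_index a c) i * H i (mxvec_index b d)).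
  by apply: eq_bigr => i _; rewrite tensmxE !mxE !mxvecE.
by rewrite HGe; apply: eq_bigr => i _; rewrite tensmxE !mxE !mxvecE.
Qed.

(** The reflection along [W] is an isometry of the bilinear trace form. *)
Lemma mxtrace_reflection W X Y (w := \tr (W *m W)) : w != 0 ->
  \tr ((X - (2 / w * \tr (X *m W)) *: W) *m (Y - (2 / w * \tr (Y *m W)) *: W)) =
  \tr (X *m Y).
Proof.
move=> w0; rewrite mulmxBl !mulmxBr -!scalemxAl -!scalemxAr.
rewrite !linearB /= !linearZ /= -/w [\tr (W *m Y)]mxtrace_mulC.
by field.
Qed.

(* Reflect [g] in the hyperplane orthogonal to [W := Q - g ord0]. *)
Lemma trace_orthonormal_replace_head n (g : 'I_n.+1 -> 'M[C]_k) Q :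
    (forall i, (g i)^t* = g i) -> trace_orthonormal g ->
    Q^t* = Q -> spanproj g Q = Q -> \tr (Q *m Q) = 1 ->
  exists h : 'I_n.+1 -> 'M[C]_k, [/\ forall i, (h i)^t* = h i,
    trace_orthonormal h, h ord0 = Q & \sum_i h i *t h i = \sum_i g i *t g i].
Proof.
move=> g_herm g_orth hQ PQ Q1.
have [Qg|Qg] := eqVneq Q (g ord0); first by exists g.
pose W := Q - g ord0; pose w := \tr (W *m W).
have hW : W^t* = W by rewrite adjmxB hQ g_herm.
have w0 : w != 0.
  apply: contra_neq Qg => w0; apply/eqP; rewrite -subr_eq0; apply/eqP.
  by apply: mxtrace_gram_eq0; rewrite hW.
have tr_real X Y : X^t* = X -> Y^t* = Y -> (\tr (X *m Y))^* = \tr (X *m Y).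
  by move=> hX hY; rewrite -mxtrace_adj adjmxM hX hY mxtrace_mulC.
pose h i := g i - (2 / w * \tr (g i *m W)) *: W.
have h_orth : trace_orthonormal h.
  by move=> i j; rewrite -g_orth mxtrace_reflection.
exists h; split=> //.
- move=> i; rewrite /h adjmxB adjmxZ hW g_herm; congr (_ - _ *: _).
  by rewrite !rmorphM /= fmorphV /= rmorph_nat !tr_real.
- have gW : \tr (g ord0 *m W) = \tr (Q *m g ord0) - 1.
    by rewrite mulmxBr linearB /= g_orth eqxx [\tr (_ *m Q)]mxtrace_mulC.
  (* Since [Q] and [g ord0] both have norm 1, the coefficient of [W] in the reflection of [g ord0]
     is -1, so the image is [g ord0 + W = Q]. *)
  have wE : w = - 2 * \tr (g ord0 *m W).
    rewrite gW /w mulmxBl !mulmxBr !linearB /= Q1 g_orth eqxx mulr1n.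
    by rewrite [\tr (g ord0 *m Q)]mxtrace_mulC; ring.
  rewrite /h -mulrA mulrCA; have -> : w^-1 * (2 * \tr (g ord0 *m W)) = -1.
    by rewrite -[2 * _]opprK -mulNr -wE mulrN mulVf.
  by rewrite scaleN1r opprK addrC subrK.
- apply: sum_tens_orthonormal_change => // i.
  by rewrite spanprojD spanprojN spanprojZ spanproj_id // spanprojD spanprojN
    PQ spanproj_id.
Qed.

Lemma psdmx_trace_sqr_gt0 Q : Q^t* = Q -> Q != 0 -> 0 < \tr (Q *m Q).
Proof.
move=> hQ Q0; rewrite lt_neqAle -{3}hQ mxtrace_gram_ge0 andbT eq_sym.
by apply: contra_neq Q0 => Q0; apply: mxtrace_gram_eq0; rewrite hQ.
Qed.

Lemma psdmxZ a Q : 0 <= a -> psdmx Q -> psdmx (a *: Q).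
Proof.
move=> a0 [/hermsymmxP hQ Q0]; split.
  by apply/hermsymmxP; rewrite adjmxZ hQ (CrealP (ger0_real a0)).
by move=> x; rewrite -scalemxAr -scalemxAl mxE mulr_ge0.
Qed.

Lemma psdmx_decomposition n (g : 'I_n -> 'M[C]_k) :
    (forall i, (g i)^t* = g i) -> trace_orthonormal g ->
    psdmx (\sum_i g i *t g i) ->
  exists h : 'I_n -> 'M[C]_k, [/\ trace_orthonormal h,
    \sum_i h i *t h i = \sum_i g i *t g i & forall i, psdmx (h i)].
Proof.
elim: n g => [|n IHn] g g_herm g_orth g_psd.
  by exists g; split=> // -[].
have [Q0 [Q0_psd PQ0 Q0n Q0_atom]] := spanproj_atom g_herm g_orth g_psd ord0.
have hQ0 : Q0^t* = Q0 by case: Q0_psd => /hermsymmxP.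
pose c := (sqrtC (\tr (Q0 *m Q0)))^-1.
have tr0 := psdmx_trace_sqr_gt0 hQ0 Q0n.
have c0 : 0 < c by rewrite invr_gt0 sqrtC_gt0.
pose Q := c *: Q0.
have Q_psd : psdmx Q by apply/psdmxZ/Q0_psd/ltW.
have hQ : Q^t* = Q by case: Q_psd => /hermsymmxP.
have PQ : spanproj g Q = Q by rewrite spanprojZ PQ0.
have Q1 : \tr (Q *m Q) = 1.
  rewrite -scalemxAl -scalemxAr !linearZ /= mulrA -expr2 exprVn sqrtCK.
  by rewrite mulVf // gt_eqF.
have [h [h_herm h_orth h0 hg]] :=
  trace_orthonormal_replace_head g_herm g_orth hQ PQ Q1.
have Pgh X : spanproj h X = spanproj g X by apply: eq_spanproj.
have h_psd : psdmx (\sum_i h i *t h i) by rewrite hg.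
have PhQ : spanproj h Q = Q by rewrite Pgh.
pose t i := h (lift ord0 i).
have hsum : \sum_i h i *t h i = Q *t Q + \sum_i t i *t t i.
  by rewrite big_ord_recl h0.
have t_herm i : (t i)^t* = t i by apply: h_herm.
have t_orth : trace_orthonormal t.
  by move=> i j; rewrite h_orth (inj_eq lift_inj).
have Qt i : \tr (Q *m t i) = 0 by rewrite -h0 h_orth (negPf (neq_lift _ _)).
have [E [R [E_adj EE EQ E_Q]]] := psdmx_support Q_psd.
have E_Q0 : (E <= Q0)%MS.
  by rewrite -E_adj E_Q adjmxM hQ -scalemxAr scalemx_sub // submxMl.
pose F := 1%:M - E.
have F_adj : F^t* = F by rewrite adjmxB adjmx1 E_adj.
have FQ : F *m Q = 0 by rewrite mulmxBl mul1mx EQ subrr.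
(* The [E] block of [t i] is a multiple of the atom [Q0], and orthogonality of [t i] to [Q] makes
   that multiple zero. *)
have tF i : F *m t i *m F = t i.
  have [tE Pt] := spanproj_fixed_block h_herm h_orth h_psd Q_psd PhQ E_adj EE EQ E_Q
    (spanproj_id h_orth (lift ord0 i)).
  rewrite -/(t i) in tE Pt.
  have QE : Q *m E = Q by rewrite -{1}hQ -E_adj -adjmxM EQ hQ.
  have [d Ed] : exists d, E *m t i *m E = d *: Q0.
    apply: Q0_atom; last 1 first.
    - exact: submx_trans (submxMl _ _) E_Q0.
    - by apply/hermsymmxP; rewrite !adjmxM E_adj t_herm mulmxA.
    - by rewrite -Pgh.
  suff EtE : E *m t i *m E = 0 by rewrite {2}tE EtE add0r.
  have : \tr (Q *m (E *m t i *m E)) = 0.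
    by rewrite !mulmxA QE mxtrace_mulC mulmxA EQ Qt.
  rewrite Ed -scalemxAl -scalemxAr !linearZ /= => /eqP.
  by rewrite !mulf_eq0 (gt_eqF c0) (gt_eqF tr0) orbF => /eqP->; rewrite scale0r.
have t_psd : psdmx (\sum_i t i *t t i).
  (* Compression by [F *t F] removes [Q *t Q] and fixes each [t i *t t i]. *)
  have -> : \sum_i t i *t t i =
      (F *t F)^t* *m (\sum_i h i *t h i) *m (F *t F).
    rewrite adjmx_tens F_adj hsum mulmxDr tensmx_mul FQ tens0mx add0r.
    rewrite mulmx_tens_suml mulmx_tens_sumr.
    by apply: eq_bigr => i _; rewrite tF.
  exact: psdmx_congr.
have [u [u_orth ut u_psd]] := IHn t t_herm t_orth t_psd.
pose q i := if unlift ord0 i is Some j then u j else Q.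
have q0 : q ord0 = Q by rewrite /q unlift_none.
have qS i : q (lift ord0 i) = u i by rewrite /q liftK.
(* Equal tensor sums give equal projections, so [u i] lies in the span of [t], which is orthogonal
   to [Q]. *)
have Qu i : \tr (Q *m u i) = 0.
  rewrite -[u i](spanproj_id u_orth) (eq_spanproj _ ut) -spanproj_sym.
  by rewrite mxtrace_spanproj big1 // => j _; rewrite Qt mul0r.
exists q; split.
- move=> i j; case: (unliftP ord0 i) => [i'|] ->; case: (unliftP ord0 j) => [j'|] ->.
  + by rewrite !qS u_orth (inj_eq lift_inj).
  + by rewrite qS q0 mxtrace_mulC Qu eq_sym (negPf (neq_lift _ _)).
  + by rewrite qS q0 Qu (negPf (neq_lift _ _)).
  + by rewrite q0 Q1 eqxx.
- rewrite big_ord_recl q0 -hg hsum -ut; congr (_ + _).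
  by apply: eq_bigr => i _; rewrite qS.
- by move=> i; case: (unliftP ord0 i) => [i'|] ->; rewrite ?qS ?q0.
Qed.

Lemma psdmx_decomposition_unique n (g h : 'I_n -> 'M[C]_k) :
    trace_orthonormal g -> trace_orthonormal h ->
    (forall i, psdmx (g i)) -> (forall i, psdmx (h i)) ->
    \sum_i h i *t h i = \sum_i g i *t g i ->
  exists s : 'S_n, forall i, h i = g (s i).
Proof.
move=> g_orth h_orth g_psd h_psd hg.
pose c i j := \tr (h i *m g j).
have c_ge0 i j : 0 <= c i j by apply: psdmx_tr_mul_ge0.
have hE i : h i = \sum_j c i j *: g j.
  by rewrite -[LHS](spanproj_id h_orth) (eq_spanproj _ hg).
have c_orth i j : \sum_l c i l * c j l = (i == j)%:R.
  rewrite -h_orth (hE i) mulmx_suml linear_sum; apply: eq_bigr => l _ /=.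
  by rewrite -scalemxAl linearZ /= [\tr (g l *m _)]mxtrace_mulC.
(* Orthogonal rows with nonnegative entries have disjoint supports. *)
have c_disj i j l : i != j -> c i l * c j l = 0.
  move=> /negPf ij; have := c_orth i j; rewrite ij => c0.
  exact: (psumr_eq0P (fun l _ => mulr_ge0 (c_ge0 i l) (c_ge0 j l)) c0).
have c_ex i : exists l, c i l != 0.
  apply/existsP; apply: contraT => /existsPn c0.
  have /eqP := c_orth i i; rewrite eqxx big1 ?(eq_sym 0) ?oner_eq0 // => l _.
  by rewrite (eqP (negbNE (c0 l))) mul0r.
pose s i := xchoose (c_ex i).
have cs i : c i (s i) != 0 by apply: xchooseP (c_ex i).
have c_supp i j : i != j -> c i (s j) = 0.
  by move=> ij; have /eqP := c_disj i j (s j) ij;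
    rewrite mulf_eq0 (negPf (cs j)) orbF => /eqP.
have s_inj : injective s.
  move=> i j sij; apply/eqP; apply: contraT => /c_supp ij.
  by have := cs i; rewrite sij ij eqxx.
exists (perm s_inj) => i; rewrite permE.
(* [s] is injective on a finite type, hence onto: every column [j != s i] is in the support of
   another row. *)
have c_perm j : j != s i -> c i j = 0.
  have /mapP[l _ ->] : j \in codom s by rewrite (fintype.injF_onto s_inj).
  by rewrite (inj_eq s_inj) eq_sym => /c_supp.
have := c_orth i i; rewrite (bigD1 (s i)) //= big1 ?addr0; last first.
  by move=> j /c_perm->; rewrite mul0r.
rewrite eqxx -expr2 => /eqP; rewrite sqrp_eq1 // => /eqP c1.
rewrite hE (bigD1 (s i)) //= big1 ?addr0 ?c1 ?scale1r // => j /c_perm->.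
by rewrite scale0r.
Qed.

(** For Hermitian families the adjoint in [mxinner] disappears, leaving the bilinear trace form. *)
Lemma unit_schmidtP n (A : 'M[C]_(k * k)) (g : 'I_n -> 'M[C]_k) :
  unit_schmidt A g <->
  [/\ forall i, (g i)^t* = g i, trace_orthonormal g & A = \sum_i g i *t g i].
Proof.
have sumE : \sum_i 1 *: (g i *t g i) = \sum_i g i *t g i.
  by apply: eq_bigr => i _; rewrite scale1r.
split=> [[_ gh go _ ->]|[gh go ->]].
  have {}gh i : (g i)^t* = g i by have [/hermsymmxP] := gh i.
  by split=> // i j; rewrite -go /mxinner gh.
have go' : orthonormal_mxs g by move=> i j; rewrite /mxinner gh.
rewrite /unit_schmidt /hermitian_schmidt sumE; split=> // i.
by split; apply/hermsymmxP.
Qed.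

End Decompositions.

Theorem theorem2p7 (R : realType) (k n : nat) (A : 'M[R[i]]_(k * k))
    (gamma : 'I_n -> 'M[R[i]]_k)
    (hA : is_SPC A) (hgamma : unit_schmidt A gamma) :
  (exists gamma' : 'I_n -> 'M[R[i]]_k,
     unit_schmidt A gamma' /\ (forall i, psdmx (gamma' i)))
  /\
  (forall gamma1 gamma2 : 'I_n -> 'M[R[i]]_k,
     unit_schmidt A gamma1 -> (forall i, psdmx (gamma1 i)) ->
     unit_schmidt A gamma2 -> (forall i, psdmx (gamma2 i)) ->
     exists s : 'S_n, forall i, gamma2 i = gamma1 (s i)).
Proof.
split=> [|g1 g2 /unit_schmidtP[_ g1o A1] g1p /unit_schmidtP[_ g2o A2] g2p].
  have [A_psd _] := hA; have /unit_schmidtP[gh go gA] := hgamma.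
  rewrite gA in A_psd; have [h [ho hg hp]] := psdmx_decomposition gh go A_psd.
  exists h; split=> //; apply/unit_schmidtP; split; rewrite ?hg // => i.
  by have [/hermsymmxP] := hp i.
by apply: psdmx_decomposition_unique; rewrite // -A1 -A2.
Qed.
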